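(* For every integer $n\ge 8$, the disjunctive domination number of the torus grid graph $C_8\Box C_n$ satisfies $$n\le \gamma_2^d(C_8\Box C_n)\le\begin{cases} n+1, & n\equiv 1 \text{ or } 3\pmod 4,\\ n+2, & n\equiv 2\pmod 4.\end{cases}$$ Moreover, if $n\equiv 0\pmod 4$, then $\gamma_2^d(C_8\Box C_n)=n$.
   Context: $C_k$ denotes the cycle on $k$ vertices, and $G\Box H$ is the Cartesian product: vertex set $V(G)\times V(H)$, with $(g,h)\sim(g',h')$ iff either $g=g'$ and $hh'\in E(H)$, or $h=h'$ and $gg'\in E(G)$. For a simple graph $\Gamma$ and a vertex $v$, let $\Gamma(v)$ be the set of vertices at distance $1$ from $v$ and $\Gamma_2(v)$ the set of vertices at distance exactly $2$ from $v$. A set $S\subseteq V(\Gamma)$ is a disjunctive dominating set if every vertex $v\notin S$ satisfies $|\Gamma(v)\cap S|\ge 1$ or $|\Gamma_2(v)\cap S|\ge 2$. The disjunctive domination number $\gamma_2^d(\Gamma)$ is the minimum cardinality of a disjunctive dominating set of $\Gamma$. *)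

(* Defs.v *)
From mathcomp Require Import all_boot.
Set Implicit Arguments. Unset Strict Implicit. Unset Printing Implicit Defensive.

Section Graph.
Variables (T : finType) (e : rel T).

Definition nbhd (v : T) : {set T} := [set u | (u != v) && e v u].

Definition nbhd2 (v : T) : {set T} :=
  [set u | [&& u != v, u \notin nbhd v & [exists w, (w \in nbhd v) && (u \in nbhd w)]]].

Definition disj_dominating (S : {set T}) : bool :=
  [forall v, (v \notin S) ==> ((0 < #|nbhd v :&: S|) || (2 <= #|nbhd2 v :&: S|))].

Lemma disj_dominating_setT : disj_dominating setT.
Proof. by apply/forallP => v; rewrite in_setT. Qed.

Definition gamma2d : nat :=
  #|[arg min_(S < setT | disj_dominating S) #|S|]|.
End Graph.

Definition cycle_rel (k : nat) : rel 'I_k :=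
  fun i j => (i != j) && ((j == (i.+1 %% k) :> nat) || (i == (j.+1 %% k) :> nat)).

Definition cart_rel (A B : finType) (eA : rel A) (eB : rel B) : rel (A * B) :=
  fun x y => ((x.1 == y.1) && eB x.2 y.2) || ((x.2 == y.2) && eA x.1 y.1).

Arguments cycle_rel : clear implicits.
Definition torus_rel (m n : nat) : rel ('I_m * 'I_n) :=
  cart_rel (cycle_rel m) (cycle_rel n).
Arguments torus_rel : clear implicits.
Arguments cycle_rel : clear implicits.

(* Main.v *)
(* Lower bound.  Give each vertex weight 2 for itself and each neighbour in S
   and 1 for each member of S at distance two; domination makes every weight at
   least 2.  Summing over a column, the column counts a_j satisfy
   8 a_j + 4 (a_(j-1) + a_(j+1)) + a_(j-2) + a_(j+2) >= 16.  Summing this over j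
   only yields 8n/9, so integrality is used, by discharging: each column starts
   with charge a_j and a nonempty column sends its surplus a_j - 1 to nearby
   empty columns.  A column with a_j = 2 gives 1 to its only empty neighbour, or
   1/2 to each of two; one with a_j >= 3 gives 1 to each empty neighbour; one with
   a_j >= 5 also gives 1 to each empty column at distance two, as does one with
   a_j = 4 when the column in between is nonempty.  The inequality shows that
   every column ends with charge at least 1.
   Upper bound.  Columns {0,4}, {}, {2,6}, {} repeated, adjusted at the seam. *)
Require Import Defs.
From mathcomp Require Import all_boot.
From mathcomp Require Import zify.

Lemma gamma2d_le (T : finType) (e : rel T) (S : {set T}) :
  disj_dominating e S -> gamma2d e <= #|S|.
Proof.
by rewrite /gamma2d; case: arg_minnP => [|A _ /(_ S)]; rewrite ?disj_dominating_setT.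
Qed.

Lemma gamma2d_ge (T : finType) (e : rel T) (k : nat) :
  (forall S, disj_dominating e S -> k <= #|S|) -> k <= gamma2d e.
Proof.
by move=> H; rewrite /gamma2d; case: arg_minnP => [|A /H]; rewrite ?disj_dominating_setT.
Qed.

(** * Neighbours in the torus as explicit lists *)

Lemma cycle_relP {n : nat} {i j : 'I_n} :
  cycle_rel n i j -> j = ordS i \/ j = ord_pred i.
Proof.
case/andP=> _ /orP [/eqP h|/eqP h]; [left|right]; first exact: val_inj.
by rewrite -[j]ordSK; congr ord_pred; apply: val_inj.
Qed.

(** In a list, each position can be summed over a column by a shift; repeated entries only enlarge
    counts, which is harmless in bounds from above. *)
Definition ring1 {m n : nat} (v : 'I_m * 'I_n) : seq ('I_m * 'I_n) :=
  [:: (ordS v.1, v.2); (ord_pred v.1, v.2); (v.1, ordS v.2); (v.1, ord_pred v.2)].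

Definition ring2 {m n : nat} (v : 'I_m * 'I_n) : seq ('I_m * 'I_n) :=
  [:: (ordS (ordS v.1), v.2); (ord_pred (ord_pred v.1), v.2);
      (v.1, ordS (ordS v.2)); (v.1, ord_pred (ord_pred v.2));
      (ordS v.1, ordS v.2); (ordS v.1, ord_pred v.2);
      (ord_pred v.1, ordS v.2); (ord_pred v.1, ord_pred v.2)].

Lemma mem_nbhd_ring1 {m n : nat} {u v : 'I_m * 'I_n} :
  u \in nbhd (torus_rel m n) v -> u \in ring1 v.
Proof.
case: u v => [u1 u2] [v1 v2]; rewrite inE => /andP [_ /orP [] /andP [/eqP /= -> /cycle_relP]].
  by case=> ->; rewrite !inE eqxx ?orbT.
by case=> ->; rewrite !inE eqxx ?orbT.
Qed.

Lemma mem_nbhd2_ring2 {m n : nat} {u v : 'I_m * 'I_n} :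
  u \in nbhd2 (torus_rel m n) v -> u \in ring2 v.
Proof.
rewrite inE => /and3P [neq_uv _ /existsP [w /andP [/mem_nbhd_ring1 vw /mem_nbhd_ring1]]].
move: vw neq_uv; case: v => [v1 v2]; rewrite !inE.
(* Of the sixteen two-step walks, the four that return to [v] contradict [neq_uv]. *)
by move=> /or4P [] /eqP -> neq_uv /or4P [] /eqP uE; move: neq_uv; rewrite uE;
   rewrite /= ?ordSK ?ord_predK ?eqxx ?orbT.
Qed.

(** * Lower bound: weights summed over a column *)

Section LowerBound.
Variables (m n : nat) (S : {set 'I_m * 'I_n}).

Definition col (j : 'I_n) : nat := \sum_(i < m) ((i, j) \in S).

Lemma sum_col : \sum_j col j = #|S|.
Proof.
rewrite exchange_big pair_big /= -sum1_card [RHS]big_mkcond.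
by apply: eq_bigr => -[i j] _; case: (_ \in S).
Qed.

Lemma card_setI_count (A : {set 'I_m * 'I_n}) s :
  {subset A <= s} -> #|A :&: S| <= count (mem S) s.
Proof.
move=> sub; rewrite -size_filter; apply: leq_trans (card_size _).
apply/subset_leq_card/subsetP => x; rewrite mem_filter => /setIP [xA xS].
by rewrite inE xS sub.
Qed.

Hypothesis dom : disj_dominating (torus_rel m n) S.

Lemma dominated_weight v :
  2 <= 2 * (v \in S) + 2 * count (mem S) (ring1 v) + count (mem S) (ring2 v).
Proof.
have le1 := @card_setI_count _ (ring1 v) (fun u => @mem_nbhd_ring1 m n u v).
have le2 := @card_setI_count _ (ring2 v) (fun u => @mem_nbhd2_ring2 m n u v).
move/forallP/(_ v): dom; case: (v \in S) => // /orP [/leq_trans/(_ le1)|/leq_trans/(_ le2)].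
  by move: (count _ _) (count _ _) => c1 c2; lia.
by move: (count _ _) (count _ _) => c1 c2; lia.
Qed.

(** The 8 is 2 for the vertex, 4 for its two neighbours in the column and 2 for the two vertices two
    rows away; each 4 is 2 for the adjacent vertex and 1 for each of two diagonal ones. *)
Lemma col_weight j :
  2 * m <= 8 * col j + 4 * (col (ordS j) + col (ord_pred j))
           + (col (ordS (ordS j)) + col (ord_pred (ord_pred j))).
Proof.
have shiftS k : col k = \sum_(i < m) ((ordS i, k) \in S).
  by rewrite /col (reindex_inj (@ordS_inj m)).
have shiftP k : col k = \sum_(i < m) ((ord_pred i, k) \in S).
  by rewrite /col (reindex_inj (@ord_pred_inj m)).
have shiftSS k : col k = \sum_(i < m) ((ordS (ordS i), k) \in S).
  by rewrite shiftS (reindex_inj (@ordS_inj m)).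
have shiftPP k : col k = \sum_(i < m) ((ord_pred (ord_pred i), k) \in S).
  by rewrite shiftP (reindex_inj (@ord_pred_inj m)).
have: \sum_(i < m) 2 <= \sum_(i < m) (2 * ((i, j) \in S)
     + 2 * count (mem S) (ring1 (i, j)) + count (mem S) (ring2 (i, j))).
  by apply: leq_sum => i _; apply: dominated_weight.
rewrite sum_nat_const card_ord /= !(big_split, =^~ big_distrr) /=.
rewrite -!shiftS -!shiftP -!shiftSS -!shiftPP -!/(col _) big1 //.
by rewrite -!/(col _); lia.
Qed.

End LowerBound.

(** * Lower bound: discharging on a cyclic sequence *)

Arguments col {m n} S j.

(* Twice the charge sent by a column of count [a] to an empty neighbour; [l] is
   the count of its other neighbour. *)
Definition give1 (l a : nat) : nat :=
  if a <= 1 then 0 else if (a == 2) && (l == 0) then 1 else 2.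

(* Twice the charge sent by a column of count [a] to an empty column at distance
   two; [b] is the count of the column in between. *)
Definition give2 (b a : nat) : nat :=
  if (5 <= a) || (a == 4) && (0 < b) then 2 else 0.

(** When [a] is 4, each side takes at most 1, since [give1] needs the adjacent column empty and
    [give2] needs it nonempty. From 5 on, the surplus pays all four recipients. *)
Lemma give_bound (l2 l a r r2 : nat) :
  (0 < a).*2 + ((l == 0) * give1 r a + (r == 0) * give1 l a
  + ((l2 == 0) * give2 l a + (r2 == 0) * give2 r a)) <= 2 * a.
Proof.
rewrite /give1 /give2.
case: l => [|l]; case: r => [|r]; case: l2 => [|l2]; case: r2 => [|r2];
case: a => [|[|[|[|[|a]]]]] //=; lia.
Qed.

(** If both neighbours of an empty column are at most 1, the counts at distance two sum to at least
    8, so one is at least 5 or both are 4 behind nonempty columns. If a neighbour of count 2 sends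
    only 1/2, the weight still required from the other side is 8, enough to make it send the
    rest. *)
Lemma receive_bound (l2 l a r r2 : nat) :
  16 <= 8 * a + 4 * (r + l) + (r2 + l2) ->
  2 <= (0 < a).*2 + ((a == 0) * give1 r2 r + (a == 0) * give1 l2 l
  + ((a == 0) * give2 r r2 + (a == 0) * give2 l l2)).
Proof.
case: a => [|a] //=; rewrite /give1 /give2.
case: l => [|[|[|l]]]; case: r => [|[|[|r]]];
case: l2 => [|[|[|[|[|l2]]]]]; case: r2 => [|[|[|[|[|r2]]]]] //=; lia.
Qed.

Lemma sum_ge_size (n : nat) (a : 'I_n -> nat) :
  (forall j, 16 <= 8 * a j + 4 * (a (ordS j) + a (ord_pred j))
             + (a (ordS (ordS j)) + a (ord_pred (ord_pred j)))) ->
  n <= \sum_j a j.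
Proof.
move=> H.
have SI (F : 'I_n -> nat) : \sum_j F j = \sum_j F (ordS j).
  by rewrite (reindex_inj (@ordS_inj n)).
have PI (F : 'I_n -> nat) : \sum_j F j = \sum_j F (ord_pred j).
  by rewrite (reindex_inj (@ord_pred_inj n)).
(* Reindexing by a shift turns the charge received from one direction into the charge sent along
   it. *)
have flowP1 : \sum_j (a j == 0) * give1 (a (ordS (ordS j))) (a (ordS j))
    = \sum_j (a (ord_pred j) == 0) * give1 (a (ordS j)) (a j).
  by rewrite [LHS]PI; apply: eq_bigr => j _; rewrite !ord_predK.
have flowS1 : \sum_j (a j == 0) * give1 (a (ord_pred (ord_pred j))) (a (ord_pred j))
    = \sum_j (a (ordS j) == 0) * give1 (a (ord_pred j)) (a j).
  by rewrite [LHS]SI; apply: eq_bigr => j _; rewrite !ordSK.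
have flowP2 : \sum_j (a j == 0) * give2 (a (ordS j)) (a (ordS (ordS j)))
    = \sum_j (a (ord_pred (ord_pred j)) == 0) * give2 (a (ord_pred j)) (a j).
  by rewrite [LHS]PI [LHS]PI; apply: eq_bigr => j _; rewrite !ord_predK.
have flowS2 : \sum_j (a j == 0) * give2 (a (ord_pred j)) (a (ord_pred (ord_pred j)))
    = \sum_j (a (ordS (ordS j)) == 0) * give2 (a (ordS j)) (a j).
  by rewrite [LHS]SI [LHS]SI; apply: eq_bigr => j _; rewrite !ordSK.
rewrite -(leq_pmul2l (isT : 0 < 2)) mulnC big_distrr /=.
have -> : n * 2 = \sum_(j < n) 2 by rewrite sum_nat_const card_ord.
apply: leq_trans (leq_sum _ _) _ => [j _|]; first exact: receive_bound _ _ _ _ _ (H j).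
rewrite 4!big_split /= flowP1 flowS1 flowP2 flowS2 -!big_split.
by apply: leq_sum => j _; apply: give_bound.
Qed.

(** * Upper bound: adjacency by coordinates and a periodic dominating set *)

Lemma val_ordS (n : nat) (j : 'I_n) :
  ordS j = (if j.+1 == n then 0 else j.+1) :> nat.
Proof.
have ltjn := ltn_ord j; rewrite /=.
by case: eqP => [->|?]; rewrite ?modnn // modn_small //; lia.
Qed.

Lemma cycle_relE (n : nat) (i j : 'I_n) :
  cycle_rel n i j = (i != j :> nat) &&
    [|| j == i.+1 :> nat, i == j.+1 :> nat, (i.+1 == n) && (j == 0 :> nat)
      | (j.+1 == n) && (i == 0 :> nat)].
Proof.
rewrite /cycle_rel -val_eqE; have /= -> := val_ordS n i; have /= -> := val_ordS n j.
have := ltn_ord i; have := ltn_ord j.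
by case: (i.+1 =P n); case: (j.+1 =P n); lia.
Qed.

Lemma mem_nbhd_torus (m n : nat) (i x : 'I_m) (j y : 'I_n) :
  ((x, y) \in nbhd (torus_rel m n) (i, j)) =
  ((x == i) && cycle_rel n j y) || ((y == j) && cycle_rel m i x).
Proof.
rewrite inE /torus_rel /cart_rel /= (eq_sym i) (eq_sym j) xpair_eqE.
by rewrite /cycle_rel (eq_sym j) (eq_sym i); case: (x == i); case: (y == j).
Qed.

Lemma mem_nbhd2 (T : finType) (e : rel T) (u v w : T) :
  u != v -> u \notin nbhd e v -> w \in nbhd e v -> u \in nbhd e w ->
  u \in nbhd2 e v.
Proof. by move=> uv uNv wv uw; rewrite inE uv uNv; apply/existsP; exists w; rewrite wv. Qed.

Lemma val_ord_pred (n : nat) (j : 'I_n) :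
  ord_pred j = (if j == 0 :> nat then n.-1 else j.-1) :> nat.
Proof.
have ltjn := ltn_ord j; rewrite /=.
case: eqP => [->|?]; first by rewrite modn_small //; lia.
by rewrite (_ : (j + n).-1 = j.-1 + n) ?modnDr ?modn_small; lia.
Qed.

Lemma mem_nbhd2_diag (m n : nat) (i x : 'I_m) (j y : 'I_n) :
  cycle_rel m i x -> cycle_rel n j y ->
  (x, y) \in nbhd2 (torus_rel m n) (i, j).
Proof.
move=> ix jy; have [neq_ix _] := andP ix; have [neq_jy _] := andP jy.
apply: (@mem_nbhd2 _ _ _ _ (x, j)).
- by rewrite xpair_eqE eq_sym (negPf neq_ix).
- by rewrite mem_nbhd_torus eq_sym (negPf neq_ix) eq_sym (negPf neq_jy).
- by rewrite mem_nbhd_torus eqxx ix orbT.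
- by rewrite mem_nbhd_torus eqxx jy.
Qed.

Lemma mem_nbhd2_col (m n : nat) (i x z : 'I_m) (j : 'I_n) :
  cycle_rel m i x -> cycle_rel m x z -> z != i -> ~~ cycle_rel m i z ->
  (z, j) \in nbhd2 (torus_rel m n) (i, j).
Proof.
move=> ix xz neq_zi not_iz; apply: (@mem_nbhd2 _ _ _ _ (x, j)).
- by rewrite xpair_eqE (negPf neq_zi).
- by rewrite mem_nbhd_torus (negPf neq_zi) eqxx (negPf not_iz).
- by rewrite mem_nbhd_torus eqxx ix orbT.
- by rewrite mem_nbhd_torus eqxx xz orbT.
Qed.

Lemma ordS_spec m (k : 'I_m) :
    [/\ k < m, ordS k < m & (k.+1 = m /\ ordS k = 0 :> nat) \/ ordS k = k.+1 :> nat].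
Proof.
by have kS := val_ordS m k; split=> //; move: kS; case: ifP => *; [left|right]; lia.
Qed.

Lemma ord_pred_spec m (k : 'I_m) :
    [/\ k < m, ord_pred k < m
      & (k = 0 :> nat /\ (ord_pred k).+1 = m) \/ (ord_pred k).+1 = k :> nat].
Proof.
have kP := val_ord_pred m k; have ltkm := ltn_ord k; split=> //.
by move: kP; case: ifP => *; [left|right]; lia.
Qed.

(* Columns alternate {0,4}, {}, {2,6}, {}; when n = 2 mod 4 the last column,
   which would be an empty one between two copies of {0,4}, is {2,6}. *)
Definition torus_pattern (n : nat) : {set 'I_8 * 'I_n} :=
  [set v : 'I_8 * 'I_n | (~~ odd v.2 && (v.1 %% 4 == v.2 %% 4))
           || [&& n %% 4 == 2, v.2.+1 == n & v.1 %% 4 == 2]].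

Lemma sum_even (n : nat) : \sum_(j < n) 2 * ~~ odd j = 2 * uphalf n.
Proof. by elim: n => [|n IH]; rewrite ?big_ord0 // big_ord_recr /= IH; lia. Qed.

Lemma card_torus_pattern (n : nat) :
  #|torus_pattern n| <= 2 * uphalf n + 2 * (n %% 4 == 2).
Proof.
rewrite -sum_col; case: n => [|n]; first by rewrite big_ord0.
have colE (j : 'I_n.+1) : col (torus_pattern n.+1) j
    <= 2 * ~~ odd j + 2 * ((n.+1 %% 4 == 2) && (j == n :> nat)).
  rewrite /col !big_ord_recl big_ord0 !inE /= /bump /=.
  (* Parity is read from [j %% 4], so four residues cover the periodic part. *)
  have -> : odd j = odd (j %% 4) by lia.
  have : j %% 4 < 4 by rewrite ltn_mod.
  rewrite eqSS; move: (j %% 4) => [|[|[|[|]]]] //;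
    by case: (n.+1 %% 4 == 2); case: (val j == n).
apply: leq_trans (leq_sum _ _) _ => [j _|]; first exact: colE.
rewrite big_split /= sum_even leq_add2l big_ord_recr /= big1 ?eqxx ?andbT //.
by move=> j _; have := ltn_ord j => /=; lia.
Qed.

Lemma torus_pattern_dominating (n : nat) :
  8 <= n -> disj_dominating (torus_rel 8 n) (torus_pattern n).
Proof.
move=> n_ge8; apply/forallP => -[i j]; apply/implyP => vS; apply/orP.
have one u : u \in nbhd (torus_rel 8 n) (i, j) -> u \in torus_pattern n ->
    0 < #|nbhd (torus_rel 8 n) (i, j) :&: torus_pattern n|.
  by move=> uv uS; rewrite card_gt0; apply/set0Pn; exists u; rewrite inE uv.
have two u u' : u != u' -> u \in nbhd2 (torus_rel 8 n) (i, j) -> u \in torus_pattern n ->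
    u' \in nbhd2 (torus_rel 8 n) (i, j) -> u' \in torus_pattern n ->
    1 < #|nbhd2 (torus_rel 8 n) (i, j) :&: torus_pattern n|.
  by move=> uu' uv uS u'v u'S; apply/card_gt1P; exists u, u'; rewrite !in_setI uv uS u'v u'S.
have cycS m (k : 'I_m) : 1 < m -> cycle_rel m k (ordS k).
  by move=> m_gt1; rewrite cycle_relE; case: (ordS_spec m k); lia.
have cycP m (k : 'I_m) : 1 < m -> cycle_rel m k (ord_pred k).
  by move=> m_gt1; rewrite cycle_relE; case: (ord_pred_spec m k); lia.
have n_gt1 : 1 < n by lia.
have [iSr iPr] := (cycS _ i isT, cycP _ i isT).
have [jSr jPr] := (cycS _ j n_gt1, cycP _ j n_gt1).
(* In a column holding the rows congruent to [c] mod 4, a row at cyclic distance 1 from them is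
   adjacent to one, and a row midway is at distance two from two of them. *)
have dom_col c : c <= 3 -> i %% 4 != c ->
    (forall x : 'I_8, x %% 4 = c -> (x, j) \in torus_pattern n) ->
    0 < #|nbhd (torus_rel 8 n) (i, j) :&: torus_pattern n| \/
    1 < #|nbhd2 (torus_rel 8 n) (i, j) :&: torus_pattern n|.
  move=> c_le3 ic memc.
  have [lti ltiS iS] := ordS_spec _ i; have [_ ltiP iP] := ord_pred_spec _ i.
  have [_ ltiSS iSS] := ordS_spec _ (ordS i); have [_ ltiPP iPP] := ord_pred_spec _ (ord_pred i).
  have [up|not_up] := eqVneq (ordS i %% 4) c.
    by left; apply: (one (ordS i, j)); [rewrite mem_nbhd_torus eqxx iSr orbT|apply: memc].
  have [down|not_down] := eqVneq (ord_pred i %% 4) c.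
    by left; apply: (one (ord_pred i, j)); [rewrite mem_nbhd_torus eqxx iPr orbT|apply: memc].
  right; apply: (two (ordS (ordS i), j) (ord_pred (ord_pred i), j)).
  - by rewrite xpair_eqE eqxx andbT -(inj_eq (@ord_inj 8)); lia.
  - apply: (mem_nbhd2_col _ _ _ (ordS i)) => //; first exact: cycS.
      by rewrite -(inj_eq (@ord_inj 8)); lia.
    by rewrite cycle_relE; lia.
  - apply: memc; lia.
  - apply: (mem_nbhd2_col _ _ _ (ord_pred i)) => //; first exact: cycP.
      by rewrite -(inj_eq (@ord_inj 8)); lia.
    by rewrite cycle_relE; lia.
  - apply: memc; lia.
have [special|notspecial] := boolP ((n %% 4 == 2) && (j.+1 == n)).
  have memj (x : 'I_8) : x %% 4 = 2 -> (x, j) \in torus_pattern n.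
    by rewrite inE [_.1]/= [_.2]/=; lia.
  by apply: (dom_col _ _ _ memj) => //; apply: contra vS => /eqP /memj.
have [j_odd|j_even] := boolP (odd j); last first.
  have memj (x : 'I_8) : x %% 4 = j %% 4 -> (x, j) \in torus_pattern n.
    by rewrite inE [_.1]/= [_.2]/=; lia.
  by apply: (dom_col _ _ _ memj); [lia|apply: contra vS => /eqP /memj].
have [ltj ltjS jS] := ordS_spec _ j; have [_ ltjP jP] := ord_pred_spec _ j.
have memP (x : 'I_8) : x %% 4 = j.-1 %% 4 -> (x, ord_pred j) \in torus_pattern n.
  by rewrite inE [_.1]/= [_.2]/=; lia.
(* If this odd column is the last, then 4 divides [n], so wrapping to column 0 continues the
   pattern. *)
have memS (x : 'I_8) : x %% 4 = j.+1 %% 4 -> (x, ordS j) \in torus_pattern n.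
  by rewrite inE [_.1]/= [_.2]/=; lia.
have neq_jSP : ordS j != ord_pred j by rewrite -(inj_eq (@ord_inj n)); lia.
clear ltjS ltjP jS jP.
have [lti ltiS iS] := ordS_spec _ i; have [_ ltiP iP] := ord_pred_spec _ i.
have [left_i|not_left] := eqVneq (i %% 4) (j.-1 %% 4).
  by left; apply: (one (i, ord_pred j)); [rewrite mem_nbhd_torus eqxx jPr|apply: memP].
have [right_i|not_right] := eqVneq (i %% 4) (j.+1 %% 4).
  by left; apply: (one (i, ordS j)); [rewrite mem_nbhd_torus eqxx jSr|apply: memS].
(* Row [i] is now odd, so the rows next to it fall in the two different even classes mod 4: one
   serves in each adjacent column, diagonally. *)
right; have [up|not_up] := eqVneq (ordS i %% 4) (j.+1 %% 4).
  apply: (two (ordS i, ordS j) (ord_pred i, ord_pred j)).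
  - by rewrite xpair_eqE (negPf neq_jSP) andbF.
  - exact: mem_nbhd2_diag.
  - exact: memS.
  - exact: mem_nbhd2_diag.
  - by apply: memP; lia.
apply: (two (ord_pred i, ordS j) (ordS i, ord_pred j)).
- by rewrite xpair_eqE (negPf neq_jSP) andbF.
- exact: mem_nbhd2_diag.
- by apply: memS; lia.
- exact: mem_nbhd2_diag.
- by apply: memP; lia.
Qed.

Theorem theorem4 (n : nat) : 8 <= n ->
  n <= gamma2d (torus_rel 8 n) /\
  ((n %% 4 == 1) || (n %% 4 == 3) -> gamma2d (torus_rel 8 n) <= n + 1) /\
  (n %% 4 = 2 -> gamma2d (torus_rel 8 n) <= n + 2) /\
  (n %% 4 = 0 -> gamma2d (torus_rel 8 n) = n).
Proof.
move=> n_ge8.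
have lower : n <= gamma2d (torus_rel 8 n).
  apply: gamma2d_ge => S dom; rewrite -sum_col.
  by apply: sum_ge_size => j; apply: col_weight dom j.
(* [2 * uphalf n] is [n] or [n + 1] according to parity; only residue 2 adds a further 2. *)
have := leq_trans (gamma2d_le _ _ _ (torus_pattern_dominating _ n_ge8)) (card_torus_pattern n).
by move=> upper; do !split; move: lower upper; lia.
Qed.
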